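(* Let $N\ge2$, let $M$ be a nonzero integer, and let $t(z)$ be generators satisfying the exchange relation $t(z)t(w)=\mathcal Y_{N,p,q,M}(w/z)\,t(w)t(z)$ (with $\mathcal Y_{N,p,q,M}$ as in the context). Setting $q^{Nh}=p^{1-\beta}$ for an integer $h\neq0$ (with $q$ fixed), the $h$-labeled Poisson structure defined by $$\{t(z),t(w)\}^{(h)}=\lim_{\beta\to0}\frac1\beta\big(t(z)t(w)-t(w)t(z)\big)$$ has the expression $$\{t(z),t(w)\}^{(h)}=f_h(w/z)\,t(z)\,t(w),$$ where, writing for an integer $a$ $$G_a(x)=\frac{2x^2q^{a}}{1-x^2q^{a}}-\frac{x^2q^{a+2}}{1-x^2q^{a+2}}-\frac{x^2q^{a-2}}{1-x^2q^{a-2}},$$ one has, for $h$ odd, $$f_h(x)=2Nh\ln q\Big[\sum_{\ell\ge0}\Big(E(\tfrac{NM}2)\big(E(\tfrac{NM}2)+1\big)G_{2N\ell}(x)+E(\tfrac{NM+1}2)^2G_{2N\ell+N}(x)\Big)-\tfrac12E(\tfrac{NM}2)\big(E(\tfrac{NM}2)+1\big)G_0(x)-(x\leftrightarrow x^{-1})\Big],$$ and, for $h$ even, $$f_h(x)=N^2M(NM+1)h\ln q\Big[\sum_{\ell\ge0}G_{2N\ell}(x)-\tfrac12G_0(x)-(x\leftrightarrow x^{-1})\Big].$$ Here $E(\cdot)$ denotes the integer part (floor), and $-(x\leftrightarrow x^{-1})$ means subtracting the whole preceding expression in the square bracket with $x$ replaced by $x^{-1}$.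
   Context: $|q|<1$; $\ln q$ is a fixed logarithm of $q$, with $q^a=e^{a\ln q}$; $p$ depends on $\beta$ through $\ln p=\frac{Nh\ln q}{1-\beta}$, so that $p\to q^{Nh}$ as $\beta\to0$. $\Theta_a(z)=(z;a)_\infty(az^{-1};a)_\infty(a;a)_\infty$ with $(z;a)_\infty=\prod_{n\ge0}(1-za^n)$. The structure function is $$\mathcal Y_{N,p,q,M}(x)=\prod_{k=1}^{K}\frac{\Theta_{q^{2N}}^2(x^2p^{-k})\,\Theta_{q^{2N}}(x^2q^2p^k)\,\Theta_{q^{2N}}(x^2q^{-2}p^k)}{\Theta_{q^{2N}}^2(x^2p^k)\,\Theta_{q^{2N}}(x^2q^2p^{-k})\,\Theta_{q^{2N}}(x^2q^{-2}p^{-k})},\qquad K=\begin{cases}NM & (M>0)\\ N|M|-1 & (M<0).\end{cases}$$ The relation $t(z)t(w)=\mathcal Y_{N,p,q,M}(w/z)t(w)t(z)$ is the one satisfied, on the surface $(-p^{1/2})^{NM}=q^{-c-N}$, by the trace generators $t(z)$ of the elliptic algebra $\mathcal A_{q,p}(\widehat{sl}(N)_c)$; at $p=q^{Nh}$ one has $\mathcal Y_{N,p,q,M}=1$ and the $t(z)$ commute. The limit is the classical limit: $\frac1\beta(t(z)t(w)-t(w)t(z))=\frac1\beta(\mathcal Y_{N,p,q,M}(w/z)-1)\,t(w)t(z)$ with $t(z),t(w)$ treated as commuting at $\beta=0$. *)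

(* Defs.v *)
From HB Require Import structures.
From mathcomp Require Import all_boot all_order all_algebra.
From mathcomp Require Import complex.
From mathcomp Require Import all_classical all_reals all_analysis.

Set Implicit Arguments.
Unset Strict Implicit.
Unset Printing Implicit Defensive.

Import Order.TTheory GRing.Theory Num.Theory.
Import numFieldNormedType.Exports.

Local Open Scope classical_set_scope.
Local Open Scope ring_scope.

(* R[i] gets the topology of its modulus, as every numFieldType does. *)
HB.instance Definition _ (R : realType) := NormedModule.copy R[i] R[i]^o.

Section structure_function.
Variable R : realType.
Local Notation C := R[i].

Definition cexp (z : C) : C :=
  Complex (expR (complex.Re z) * cos (complex.Im z))
          (expR (complex.Re z) * sin (complex.Im z)).

Definition qpoch (z a : C) : C :=
  lim ((\prod_(0 <= i < n) (1 - z * a ^+ i)) @[n --> \oo]).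

Definition Theta (a z : C) : C :=
  qpoch z a * qpoch (a * z^-1) a * qpoch a a.

Definition Klen (N : nat) (M : int) : nat :=
  if 0 < M then (N * `|M|)%N else (N * `|M|).-1.

Definition Ynum (N : nat) (p q x : C) (k : nat) : C :=
  Theta (q ^+ (2 * N)) (x ^+ 2 * p ^- k) ^+ 2
  * Theta (q ^+ (2 * N)) (x ^+ 2 * q ^+ 2 * p ^+ k)
  * Theta (q ^+ (2 * N)) (x ^+ 2 * q ^- 2 * p ^+ k).

Definition Yden (N : nat) (p q x : C) (k : nat) : C :=
  Theta (q ^+ (2 * N)) (x ^+ 2 * p ^+ k) ^+ 2
  * Theta (q ^+ (2 * N)) (x ^+ 2 * q ^+ 2 * p ^- k)
  * Theta (q ^+ (2 * N)) (x ^+ 2 * q ^- 2 * p ^- k).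

Definition Yfun (N : nat) (p q : C) (M : int) (x : C) : C :=
  \prod_(1 <= k < (Klen N M).+1) (Ynum N p q x k / Yden N p q x k).

(* Y is a meromorphic function of x; away from these points none of the
   theta functions in its denominator vanishes. *)
Definition Yregular (N : nat) (p q : C) (M : int) (x : C) : Prop :=
  forall k, (1 <= k <= Klen N M)%N -> Yden N p q x k != 0.

(* ln p = N h ln q / (1 - beta), i.e. q^(N h) = p^(1 - beta). *)
Definition pbeta (N : nat) (h : int) (lnq beta : C) : C :=
  cexp (N%:R * h%:~R * lnq / (1 - beta)).

Definition Gfun (q : C) (a : int) (x : C) : C :=
  2 * (x ^+ 2 * q ^ a) / (1 - x ^+ 2 * q ^ a)
  - x ^+ 2 * q ^ (a + 2) / (1 - x ^+ 2 * q ^ (a + 2))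
  - x ^+ 2 * q ^ (a - 2) / (1 - x ^+ 2 * q ^ (a - 2)).

Definition Ehalf (n : int) : int := Num.floor (n%:~R / 2 : rat).

Definition fodd_bracket (N : nat) (q : C) (M : int) (x : C) : C :=
  let e0 := (Ehalf (N%:Z * M) * (Ehalf (N%:Z * M) + 1))%:~R : C in
  let e1 := (Ehalf (N%:Z * M + 1) ^+ 2)%:~R : C in
  lim ((\sum_(0 <= l < n) (e0 * Gfun q (2 * N * l)%N x
                           + e1 * Gfun q (2 * N * l + N)%N x)) @[n --> \oo])
  - 2^-1 * e0 * Gfun q 0 x.

Definition feven_bracket (N : nat) (q x : C) : C :=
  lim ((\sum_(0 <= l < n) Gfun q (2 * N * l)%N x) @[n --> \oo])
  - 2^-1 * Gfun q 0 x.

Definition fh (N : nat) (M h : int) (lnq x : C) : C :=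
  let q := cexp lnq in
  if odd `|h|%N then
    2 * N%:R * h%:~R * lnq * (fodd_bracket N q M x - fodd_bracket N q M x^-1)
  else
    N%:R ^+ 2 * M%:~R * (N%:R * M%:~R + 1) * h%:~R * lnq
    * (feven_bracket N q x - feven_bracket N q x^-1).

(* A beta-dependent family of associative algebras on one underlying
   topological vector space V, with product [fmul beta], continuous at
   beta = 0.  The space is common to all beta so that the limit beta -> 0
   makes sense; the products are not assumed commutative, even at 0. *)
Record algebra_family (V : topologicalLmodType C) := AlgebraFamily {
  fmul : C -> V -> V -> V;
  fmulDl : forall b u v w, fmul b (u + v) w = fmul b u w + fmul b v w;
  fmulDr : forall b u v w, fmul b u (v + w) = fmul b u v + fmul b u w;
  fmulZl : forall b c u v, fmul b (c *: u) v = c *: fmul b u v;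
  fmulZr : forall b c u v, fmul b u (c *: v) = c *: fmul b u v;
  fmulA : forall b u v w, fmul b u (fmul b v w) = fmul b (fmul b u v) w;
  fmul_continuous0 : forall u v,
    {for ((0 : C), u, v), continuous
      (fun x : C * V * V => fmul x.1.1 x.1.2 x.2)}
}.

(* [t b z] is the generator t(z) of the algebra at beta = b. *)
Definition exchange_relation (V : topologicalLmodType C) (A : algebra_family V)
    (t : C -> C -> V) (N : nat) (M h : int) (lnq b z w : C) : Prop :=
  fmul A b (t b z) (t b w) =
  Yfun N (pbeta N h lnq b) (cexp lnq) M (w / z) *: fmul A b (t b w) (t b z).

(* [P] is {t(z), t(w)}; it is unique when V is Hausdorff.  A relation rather
   than [lim], because a topologicalLmodType carries no chosen point. *)
Definition is_poisson_bracket (V : topologicalLmodType C)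
    (A : algebra_family V) (t : C -> C -> V) (z w : C) (P : V) : Prop :=
  b^-1 *: (fmul A b (t b z) (t b w) - fmul A b (t b w) (t b z))
    @[b --> (0 : C)^'] --> P.

End structure_function.

(* Main.v *)
Require Import Defs.
From HB Require Import structures.
From mathcomp Require Import all_boot all_order all_algebra.
From mathcomp Require Import complex.
From mathcomp Require Import all_classical all_reals all_analysis.
From mathcomp Require Import ring lra zify.

Set Implicit Arguments.
Unset Strict Implicit.
Unset Printing Implicit Defensive.

Import Order.TTheory GRing.Theory Num.Theory.
Import numFieldNormedType.Exports.

Local Open Scope classical_set_scope.
Local Open Scope ring_scope.

(** At [beta = 0] the structure function [Y] equals 1, so the quantity
    [(t(z) t(w) - t(w) t(z)) / beta = (Y - 1) / beta * t(w) t(z)] converges to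
    the logarithmic derivative of [Y] in [beta] at 0, times the product
    [t(w) t(z)] at [beta = 0]. Since [Y = 1] there and limits are unique in a
    Hausdorff space, that product does not depend on the order of its factors.
    It remains to compute the logarithmic derivative.

    Write [a = q^(2 N)], [y = x^2] and
    [rho(y) = Theta_a(y q^2) Theta_a(y q^-2) / Theta_a(y)^2]. Every factor of
    [Y] is [rho(y p^k) / rho(y p^-k)] ([Yfun_theta_ratio]). The
    quasi-periodicity of theta functions makes [rho] periodic under
    [y -> a y] ([theta_ratio_shift]); at [beta = 0] one has [p^2 = a^h], so
    [y p^k] and [y p^-k] are equivalent and [Y = 1] ([Yfun_pbeta0]).

    Let [D] be the derivative of [ln rho] with respect to [ln y]. Because [p]
    has logarithmic derivative [nu = N h ln q] at [beta = 0], the factor of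
    index [k] contributes [k nu (D(y p^k) + D(y p^-k)) = 2 k nu D(y p^k)]
    ([log_derivative_Yfun]). Now [p^k = q^(N h k)] is a power of [a] when [h k]
    is even, and [q^N] times one when [h k] is odd, so [D(y p^k)] is [D(y)] or
    [D(y q^N)] according to the parity of [h k] ([theta_ratio_logder_parity]).
    Summing [2 k] over all, over even or over odd [k] gives the coefficients
    of the theorem. Expanding [D] as a difference of two Lambert series gives
    the sums of the [G_a] ([theta_ratio_logderE], [GfunE]).

    The analytic input is the logarithmic derivative of an infinite product
    ([qpoch_expansion]). It follows from an expansion of finite products to
    first order whose quadratic error is uniform in the number of factors
    ([prod1B_expansion]). *)

(** * Geometrically convergent complex sequences *)

Section ComplexLimits.
Variable R : realType.
Local Notation C := R[i].

Lemma normc_i : `|'i%C : C| = 1.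
Proof. by rewrite normc_def /= expr0n /= add0r expr1n sqrtr1. Qed.

Lemma normc_ge_Im (z : C) : `|complex.Im z|%:C%C <= `|z|.
Proof.
have := normc_ge_Re (z * 'i%C).
by rewrite ReiNIm normrN normrM normc_i mulr1.
Qed.

Lemma normc_le_ReIm (z : C) :
  `|z| <= (`|complex.Re z| + `|complex.Im z|)%:C%C.
Proof.
have nC (s : R) : `|s%:C%C : C| = `|s|%:C%C.
  by rewrite normc_def /= expr0n /= addr0 sqrtr_sqr.
rewrite {1}(complexE z); apply: (le_trans (ler_normD _ _)).
by rewrite normrM normc_i mul1r !nC -rmorphD.
Qed.

Lemma cvgn_geometric_increments_real (u : nat -> R) (B r : R) :
  0 <= r < 1 -> (forall n, `|u n.+1 - u n| <= B * r ^+ n) -> cvgn u.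
Proof.
move=> /andP[r0 r1] ub.
have B0 : 0 <= B by have := le_trans (normr_ge0 _) (ub 0); rewrite expr0 mulr1.
have : cvgn (series (fun n => u n.+1 - u n)).
  apply: normed_cvg; apply: (@series_le_cvg _ _ (geometric B r)).
  - by move=> n; exact: normr_ge0.
  - by move=> n; rewrite /geometric /= mulr_ge0 ?exprn_ge0.
  - exact: ub.
  - by apply: is_cvg_geometric_series; rewrite ger0_norm.
have -> : series (fun n => u n.+1 - u n) = (fun n => u n - u 0).
  by apply/funext => n; rewrite /series /= telescope_sumr.
move=> uc; have -> : u = (fun n => (u n - u 0) + u 0).
  by apply/funext => n; rewrite subrK.
by apply: is_cvgD => //; apply: is_cvg_cst.
Qed.

(** Completeness of the complex plane in the only form used below: real and
    imaginary parts inherit the geometric bound on the increments, so both are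
    absolutely convergent telescoping series of reals. *)
Lemma cvgn_geometric_increments (u : nat -> C) (B r : R) :
  0 <= r < 1 -> (forall n, `|u n.+1 - u n| <= (B * r ^+ n)%:C%C) -> cvgn u.
Proof.
move=> r01 ub.
have /cvg_ex[/= x ux] : cvgn (fun n => complex.Re (u n)).
  apply: (@cvgn_geometric_increments_real _ B r) => // n.
  have := le_trans (normc_ge_Re (u n.+1 - u n)) (ub n).
  by rewrite raddfB /= -lecR.
have /cvg_ex[/= y uy] : cvgn (fun n => complex.Im (u n)).
  apply: (@cvgn_geometric_increments_real _ B r) => // n.
  have := le_trans (normc_ge_Im (u n.+1 - u n)) (ub n).
  by rewrite raddfB /= -lecR.
apply/cvg_ex; exists (Complex x y); apply/cvgrPdist_lt => e e0.
have [d d0 ->] : exists2 d : R, 0 < d & e = d%:C%C.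
  by case: e e0 => a b; rewrite ltcE /= => /andP[/eqP -> a0]; exists a.
have d20 : 0 < d / 2 by rewrite divr_gt0.
move/cvgrPdist_lt : ux => /(_ _ d20) ux.
move/cvgrPdist_lt : uy => /(_ _ d20) uy.
near=> n.
set v := _ - u n.
apply: (le_lt_trans (normc_le_ReIm v)).
rewrite ltcR [d]splitr; apply: ltrD.
- have -> : complex.Re v = x - complex.Re (u n) by rewrite /v raddfB.
  by near: n.
- have -> : complex.Im v = y - complex.Im (u n) by rewrite /v raddfB.
  by near: n.
Unshelve. all: by end_near. Qed.
End ComplexLimits.

(** * First-order expansion of finite products *)

Section PrincipalPart.
Variable K : numFieldType.

(** Expanding the product, everything beyond the linear term is quadratic in
    the sum of the moduli. The constant does not depend on the number of
    factors, so the bound passes to infinite products; this is what replaces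
    termwise differentiation. *)
Lemma prod1B_expansion (d : nat -> K) n (s := \sum_(0 <= i < n) `|d i|) :
  s <= 2^-1 ->
  `|\prod_(0 <= i < n) (1 - d i) - 1| <= 2 * s /\
  `|\prod_(0 <= i < n) (1 - d i) - 1 + \sum_(0 <= i < n) d i| <= 2 * s ^+ 2.
Proof.
rewrite {}/s; elim: n => [|n IHn].
  by rewrite !big_geq // subrr add0r normr0 expr0n !mulr0.
rewrite !big_nat_recr //=.
set P := \prod_(0 <= i < n) _; set S := \sum_(0 <= i < n) d i.
set s := \sum_(0 <= i < n) `|d i|; set t := `|d n| => st.
have s0 : 0 <= s by apply: sumr_ge0.
have t0 : 0 <= t by apply: normr_ge0.
have s12 : s <= 2^-1 by apply: le_trans st; rewrite lerDl.
have [h1 h2] := IHn s12; rewrite -/P -/S -/s in h1 h2.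
have P2 : `|P| <= 2.
  have -> : P = (P - 1) + 1 by rewrite subrK.
  apply: (le_trans (ler_normD _ _)); rewrite normr1 -[leRHS]natr1 lerD2r.
  by apply: (le_trans h1); rewrite -ler_pdivlMl // mulr1.
split.
- have -> : P * (1 - d n) - 1 = (P - 1) - d n * P by ring.
  apply: (le_trans (ler_normB _ _)); rewrite normrM mulrDr.
  by apply: lerD => //; rewrite mulrC ler_wpM2r.
- have -> : P * (1 - d n) - 1 + (S + d n) = (P - 1 + S) - d n * (P - 1) by ring.
  apply: (le_trans (ler_normB _ _)); rewrite normrM.
  have -> : 2 * (s + t) ^+ 2 = 2 * s ^+ 2 + (t * (2 * s) + 2 * (t * (s + t))).
    by ring.
  apply: lerD => //; apply: (@le_trans _ _ (t * (2 * s))).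
    by rewrite ler_wpM2l.
  by rewrite lerDl mulr_ge0 // mulr_ge0 // addr_ge0.
Qed.

Lemma cvg_norm_le (T : Type) (F : set_system T) (FF : ProperFilter F)
    (f : T -> K) (l M : K) :
  f x @[x --> F] --> l -> (\forall x \near F, `|f x| <= M) -> `|l| <= M.
Proof.
move=> /cvgrPdist_le fl fM; apply/ler_addgt0Pr => e e0.
have [x [/= h1 h2]] := filter_ex (filterI (fl e e0) fM).
have -> : l = (l - f x) + f x by rewrite subrK.
by apply: (le_trans (ler_normD _ _)); rewrite addrC lerD.
Qed.

Lemma cvg0_dominated (T : Type) (F : set_system T) (FF : Filter F)
    (f g : T -> K) :
  (\forall x \near F, `|f x| <= `|g x|) -> g x @[x --> F] --> 0 ->
  f x @[x --> F] --> 0.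
Proof.
move=> fg /cvgr0Pnorm_le g0; apply/cvgr0Pnorm_le => e e0.
apply: filterS2 fg (g0 _ e0) => x; exact: le_trans.
Qed.

End PrincipalPart.

(** * Series and infinite products of geometrically small terms *)

Section GeometricDecay.
Variable R : realType.
Local Notation C := R[i].
Implicit Types (d e : nat -> C) (z : C).

Lemma normC_real z : `|z| = (complex.Re `|z|)%:C%C.
Proof. by rewrite normc_def. Qed.

Lemma Cge0_real z : 0 <= z -> z = (complex.Re z)%:C%C.
Proof. by move=> z0; rewrite -(ger0_norm z0) -normC_real. Qed.

Definition geometric_decay d := exists (B r : R),
  0 <= r < 1 /\ forall i, `|d i| <= (B * r ^+ i)%:C%C.

Lemma geometric_decay_expr z : `|z| < 1 -> geometric_decay (fun i => z ^+ i).
Proof.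
rewrite normC_real => z1; exists 1, (complex.Re `|z|); split.
  by rewrite -!ltcR -lecR -normC_real normr_ge0 z1.
by move=> i; rewrite mul1r normrX normC_real rmorphXn.
Qed.

Lemma geometric_decayM d e : bounded_fun e -> geometric_decay d ->
  geometric_decay (fun i => e i * d i).
Proof.
move=> [M [Mr eM]] [B [r [r01 dB]]].
have M1 : M < `|M| + 1 by apply: (le_lt_trans (real_ler_norm Mr)); rewrite ltrDl.
have M0 : 0 <= `|M| + 1 by rewrite addr_ge0.
have [m mE] : exists m : R, `|M| + 1 = m%:C%C.
  by exists (complex.Re (`|M| + 1)); apply: Cge0_real.
exists (m * B), r; split=> // i.
rewrite normrM -mulrA rmorphM /= -mE.
by apply: ler_pM => //; apply: eM.
Qed.

Lemma geometric_decayZ z d : geometric_decay d ->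
  geometric_decay (fun i => z * d i).
Proof.
by apply: geometric_decayM; apply: cvg_seq_bounded; apply: is_cvg_cst.
Qed.

Lemma geometric_decay_cvg_series d : geometric_decay d ->
  cvgn (fun n => \sum_(0 <= i < n) d i).
Proof.
move=> [B [r [r01 dB]]]; apply: (cvgn_geometric_increments r01) => n.
by rewrite big_nat_recr //= addrAC subrr add0r; apply: dB.
Qed.

(** A bound uniform in [n] serves twice: it keeps the partial products bounded
    and it makes the first-order expansion uniform. *)
Lemma geometric_decay_sum_le d : geometric_decay d ->
  exists s : R, forall n, \sum_(0 <= i < n) `|d i| <= s%:C%C.
Proof.
move=> [B [r [/andP[r0 r1] dB]]]; exists (B / (1 - r)) => n.
have B0 : 0 <= B.
  by have := le_trans (normr_ge0 _) (dB 0); rewrite expr0 mulr1 -lecR.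
apply: (@le_trans _ _ (\sum_(0 <= i < n) (B * r ^+ i)%:C%C)).
  by apply: ler_sum => i _; apply: dB.
rewrite -rmorph_sum /= lecR -mulr_sumr ler_wpM2l //.
rewrite -[leRHS]mul1r ler_pdivlMr ?subr_gt0 // mulrC big_mkord.
have := subrX1 r n; rewrite -(opprB 1 r) mulNr => /(congr1 -%R).
by rewrite opprK opprB => <-; rewrite gerBl exprn_ge0.
Qed.

(** The partial products stay below the exponential of the sum of the moduli,
    hence their increments decay like the terms themselves. *)
Lemma geometric_decay_cvg_prod d : geometric_decay d ->
  cvgn (fun n => \prod_(0 <= i < n) (1 - d i)).
Proof.
move=> dd; have [s ds] := geometric_decay_sum_le dd.
case: dd => [B [r [r01 dB]]].
apply: (@cvgn_geometric_increments _ _ (expR s * B) r) => // n.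
rewrite big_nat_recr //=.
have -> (x y : C) : x * (1 - y) - x = - (x * y) by ring.
rewrite normrN normrM -mulrA rmorphM; apply: ler_pM => //.
rewrite normr_prod.
apply: (@le_trans _ _ (\prod_(0 <= i < n) (expR (complex.Re `|d i|))%:C%C)).
  apply: ler_prod => i _; rewrite normr_ge0 /=.
  apply: (le_trans (ler_normB _ _)); rewrite normr1 [`|d i|]normC_real.
  by rewrite -(rmorph1 (real_complex R)) -rmorphD lecR expR_ge1Dx.
rewrite -rmorph_prod /= lecR -expR_sum ler_expR -lecR rmorph_sum /=.
apply: le_trans (ds n); apply: ler_sum => i _.
by rewrite -normC_real.
Qed.

Lemma geometric_decay_cvg0 d : geometric_decay d -> d @ \oo --> 0.
Proof. by move=> /geometric_decay_cvg_series; apply: cvg_series_cvg_0. Qed.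

(** The factors [1 - d i] tend to 1, so dividing by them costs at most a
    bounded factor; a vanishing [1 - d i] gives the quotient 0, which is
    harmless. *)
Lemma geometric_decay_quot d : geometric_decay d ->
  geometric_decay (fun i => d i / (1 - d i)).
Proof.
move=> dd; have -> : (fun i => d i / (1 - d i)) = (fun i => (1 - d i)^-1 * d i).
  by apply/funext => i; rewrite mulrC.
apply: geometric_decayM => //; apply: cvg_seq_bounded; apply/cvg_ex.
exists (1 - 0)^-1; apply: cvgV; first by rewrite subr0 oner_eq0.
apply: cvgB; first exact: cvg_cst.
exact: geometric_decay_cvg0.
Qed.

(** The inverse factors are [1 + d i / (1 - d i)], again a convergent product;
    the two limits multiply to 1. *)
Lemma geometric_decay_prod_neq0 d : geometric_decay d ->
  (forall i, 1 - d i != 0) ->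
  lim ((\prod_(0 <= i < n) (1 - d i)) @[n --> \oo]) != 0.
Proof.
move=> dd d0.
have /cvg_ex[/= l dl] := geometric_decay_cvg_prod dd.
have /geometric_decay_cvg_prod/cvg_ex[/= m dm] :=
  geometric_decayZ (-1) (geometric_decay_quot dd).
rewrite (cvg_lim _ dl); last exact: norm_hausdorff.
have lm : l * m = 1.
  (* the sequence of products of the two partial products is constantly 1 *)
  have := cvg_lim (@norm_hausdorff _ C) (cvgM dl dm) => <-.
  rewrite (_ : _ \* _ = fun=> 1); first by apply: (cvg_lim (@norm_hausdorff _ C)); apply: cvg_cst.
  apply/funext => n /=; rewrite -big_split /=; apply: big1 => i _.
  rewrite mulN1r opprK mulrDr mulr1 mulrCA mulfV ?d0 // mulr1.
  by rewrite subrK.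
by apply/eqP => l0; move/eqP: lm; rewrite l0 mul0r eq_sym oner_eq0.
Qed.

End GeometricDecay.

(** * Logarithmic derivatives at 0 *)

Section LogDerivative.
Variable K : numFieldType.
Implicit Types (f g u : K -> K) (l m : K).

Lemma eq_near_cvg (T : Type) (U : topologicalType) (F : set_system T)
    {FF : Filter F} (f g : T -> U) (l m : U) : f x @[x --> F] --> l ->
  l = m -> (\forall x \near F, f x = g x) -> g x @[x --> F] --> m.
Proof.
by move=> fl <- fg; apply: cvg_trans fl; apply: near_eq_cvg.
Qed.

Definition difference_quotient_cvg f l :=
  b^-1 * (f b - f 0) @[b --> 0^'] --> l.

(** The logarithmic derivative of [f] at 0 is stated through [f b / f 0]: when
    [f 0 = 1] it reads [b^-1 * (f b - 1) --> l], which is the limit that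
    defines the Poisson bracket. *)
Definition log_derivative f l :=
  f 0 != 0 /\ difference_quotient_cvg (fun b => f b / f 0) l.

Lemma difference_quotient_continuous f l :
  difference_quotient_cvg f l -> f b @[b --> 0^'] --> f 0.
Proof.
move=> fl; have id0 : b @[b --> (0 : K)^'] --> (0 : K) by apply: nbhs_dnbhs.
refine (eq_near_cvg (cvgD (cvg_cst (f 0)) (cvgM id0 fl)) _ _).
  by rewrite mul0r addr0.
near=> b.
have b0 : b != 0 by near: b; apply: nbhs_dnbhs_neq.
by rewrite /= mulrA mulfV // mul1r addrC subrK.
Unshelve. all: by end_near. Qed.

Lemma log_derivative_difference f l :
  log_derivative f l -> difference_quotient_cvg f (f 0 * l).
Proof.
move=> [f0 fl]; refine (eq_near_cvg (cvgM (cvg_cst (f 0)) fl) erefl _).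
near=> b; rewrite /= divff //.
by rewrite mulrCA mulrBr mulr1 mulrCA divff // mulr1.
Unshelve. all: by end_near. Qed.

Lemma log_derivative_continuous f l :
  log_derivative f l -> f b @[b --> 0^'] --> f 0.
Proof. by move/log_derivative_difference/difference_quotient_continuous. Qed.

Lemma log_derivative_neq0 f l :
  log_derivative f l -> \forall b \near (0 : K)^', f b != 0.
Proof.
by move=> fl; apply: (cvgr_neq0 _ (log_derivative_continuous fl)); case: fl.
Qed.

Lemma log_derivative_cst c : c != 0 -> log_derivative (fun=> c) 0.
Proof.
by move=> c0; split=> //; apply: cvg_near_cst; near=> b; rewrite subrr mulr0.
Unshelve. all: by end_near. Qed.

Lemma log_derivativeM f g l m : log_derivative f l -> log_derivative g m ->
  log_derivative (fun b => f b * g b) (l + m).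
Proof.
move=> fl gm; have [f0 fl'] := fl; have [g0 gm'] := gm.
split; first by rewrite mulf_neq0.
have gc : g b / g 0 @[b --> 0^'] --> (1 : K).
  rewrite -(mulfV g0); apply: cvgM; last exact: cvg_cst.
  exact: log_derivative_continuous gm.
refine (eq_near_cvg (cvgD (cvgM fl' gc) gm') _ _).
  by rewrite mulr1.
near=> b => /=.
by rewrite !mulfV ?mulf_neq0 // invfM; ring.
Unshelve. all: by end_near. Qed.

Lemma log_derivativeV f l : log_derivative f l ->
  log_derivative (fun b => (f b)^-1) (- l).
Proof.
move=> fl; have [f0 fl'] := fl.
split; first by rewrite invr_neq0.
have fc : f 0 / f b @[b --> 0^'] --> (1 : K).
  rewrite -(mulfV f0); apply: cvgM; first exact: cvg_cst.
  by apply: cvgV => //; exact: log_derivative_continuous fl.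
refine (eq_near_cvg (cvgN (cvgM fl' fc)) _ _).
  by rewrite mulr1.
near=> b => /=.
have fb : f b != 0 by near: b; exact: log_derivative_neq0 fl.
by move: b^-1 => c; field; rewrite f0 fb.
Unshelve. all: by end_near. Qed.

Lemma log_derivative_div f g l m : log_derivative f l -> log_derivative g m ->
  log_derivative (fun b => f b / g b) (l - m).
Proof. by move=> fl /log_derivativeV; apply: log_derivativeM. Qed.

Lemma log_derivativeX f l n : log_derivative f l ->
  log_derivative (fun b => f b ^+ n) (n%:R * l).
Proof.
move=> fl; elim: n => [|n IHn].
  by rewrite mul0r; apply: log_derivative_cst; apply: oner_neq0.
have -> : (fun b => f b ^+ n.+1) = (fun b => f b * f b ^+ n).
  by apply/funext => b; rewrite exprS.
by rewrite -natr1 mulrDl mul1r addrC; apply: log_derivativeM.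
Qed.

Lemma log_derivative_prod (I : eqType) (s : seq I) (f : I -> K -> K)
    (l : I -> K) : (forall i, i \in s -> log_derivative (f i) (l i)) ->
  log_derivative (fun b => \prod_(i <- s) f i b) (\sum_(i <- s) l i).
Proof.
elim: s => [|i s IHs] fl.
  have -> : (fun b => \prod_(i <- [::]) f i b) = fun=> 1.
    by apply/funext => b; rewrite big_nil.
  by rewrite big_nil; apply: log_derivative_cst; apply: oner_neq0.
have -> : (fun b => \prod_(j <- i :: s) f j b) =
          (fun b => f i b * \prod_(j <- s) f j b).
  by apply/funext => b; rewrite big_cons.
rewrite big_cons; apply: log_derivativeM; first by apply: fl; rewrite mem_head.
by apply: IHs => j js; apply: fl; rewrite in_cons js orbT.
Qed.

(** A quadratic remainder is all the differentiability of the outer function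
    that is required, and it is the form in which the infinite products and
    the exponential provide it. *)
Lemma log_derivative_comp (phi : K -> K) u (lam M mu : K) :
  phi (u 0) != 0 ->
  (\forall z \near u 0, `|phi z / phi (u 0) - 1 - lam * (z - u 0)|
                        <= M * `|z - u 0| ^+ 2) ->
  difference_quotient_cvg u mu ->
  log_derivative (fun b => phi (u b)) (lam * mu).
Proof.
move=> phi0 phiM umu; split=> //.
have uc := difference_quotient_continuous umu.
have du0 : u b - u 0 @[b --> 0^'] --> (0 : K).
  refine (eq_near_cvg (cvgB uc (cvg_cst (u 0))) (subrr _) _).
  by near=> b.
pose E z := phi z / phi (u 0) - 1 - lam * (z - u 0).
have EM : \forall b \near (0 : K)^', `|E (u b)| <= M * `|u b - u 0| ^+ 2.
  exact: (uc _ phiM).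
have Eo : b^-1 * E (u b) @[b --> 0^'] --> (0 : K).
  apply: (@cvg0_dominated _ _ _ _ _
            (fun b => M * (b^-1 * (u b - u 0) * (u b - u 0)))).
    near=> b.
    have h : `|E (u b)| <= M * `|u b - u 0| ^+ 2.
      by near: b.
    rewrite normrM.
    have -> : M * (b^-1 * (u b - u 0) * (u b - u 0))
              = b^-1 * (M * (u b - u 0) ^+ 2) by ring.
    rewrite normrM ler_wpM2l //; apply: (le_trans h).
    rewrite -normrX; have := le_trans (normr_ge0 _) h; rewrite -normrX => h0.
    apply: (le_trans (real_ler_norm (ger0_real h0))).
    by rewrite !normrM normr_id.
  refine (eq_near_cvg (cvgM (cvg_cst M) (cvgM umu du0)) _ _).
    by rewrite !mulr0.
  by near=> b.
refine (eq_near_cvg (cvgD (cvgM (cvg_cst lam) umu) Eo) _ _).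
  by rewrite addr0.
near=> b => /=.
by rewrite /E mulfV //; ring.
Unshelve. all: by end_near. Qed.

End LogDerivative.

(** * Quadratic remainders of the elementary functions *)

Section RealBounds.
Variable R : realType.
Implicit Types (x y : R).

Lemma MVT0_le (f df : R -> R) (B y : R) :
  (forall x, is_derive x 1 f (df x)) -> f 0 = 0 ->
  (forall x, `|x| <= `|y| -> `|df x| <= B) -> `|f y| <= B * `|y|.
Proof.
move=> fdf f0 dfB.
have fc a b : {within `[a, b], continuous f}.
  apply: derivable_within_continuous => x _.
  by have [] := fdf x.
case: (ltgtP 0 y) => [y0|y0|<-]; last by rewrite f0 !normr0 mulr0.
- have [c] := MVT y0 (fun x _ => fdf x) (fc _ _).
  rewrite in_itv /= f0 !subr0 => /andP[c0 cy] ->.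
  by rewrite normrM ler_wpM2r //; apply: dfB; rewrite !gtr0_norm // ltW.
- have [c] := MVT y0 (fun x _ => fdf x) (fc _ _).
  rewrite in_itv /= f0 !sub0r => /andP[yc c0] /(congr1 -%R); rewrite opprK => ->.
  rewrite normrN normrM normrN ler_wpM2r //; apply: dfB.
  by rewrite !ltr0_norm // lerN2 ltW.
Qed.

Lemma abs_sin_le y : `|sin y| <= `|y|.
Proof.
rewrite -[leRHS]mul1r; apply: (MVT0_le (df := cos)); rewrite ?sin0 // => x _.
by rewrite ler_norml cos_geN1 cos_le1.
Qed.

Lemma abs_cosB1_le y : `|cos y - 1| <= y ^+ 2.
Proof.
rewrite -real_normK ?num_real // expr2.
apply: (MVT0_le (f := fun x => cos x - 1) (df := fun x => - sin x)).
- move=> x; have h : is_derive x 1 (cos - cst 1) (- sin x - 0).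
    exact: is_deriveB.
  by apply: is_derive_eq h _; rewrite subr0.
- by rewrite cos0 subrr.
- by move=> x xy; rewrite normrN; apply: (le_trans (abs_sin_le x)).
Qed.

Lemma abs_sinBid_le y : `|y| <= 1 -> `|sin y - y| <= y ^+ 2.
Proof.
move=> y1; apply: (@le_trans _ _ (y ^+ 2 * `|y|)); last first.
  by rewrite ler_piMr // sqr_ge0.
apply: (MVT0_le (f := fun x => sin x - x) (df := fun x => cos x - 1)).
- by rewrite sin0 subrr.
- move=> x xy; apply: (le_trans (abs_cosB1_le x)).
  by rewrite -[leLHS]real_normK ?num_real // -[leRHS]real_normK ?num_real // lerXn2r.
Qed.

Lemma abs_expRB1Bid_le x : `|x| <= 2^-1 -> `|expR x - 1 - x| <= 2 * x ^+ 2.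
Proof.
move=> x12; have [xl xr] : - 2^-1 <= x /\ x <= 2^-1 by apply/andP; rewrite -ler_norml.
have h1 := expR_ge1Dx x; have h2 := expR_ge1Dx (- x).
have h3 : expR x * expR (- x) = 1 by apply: expRxMexpNx_1.
have h4 := expR_gt0 x.
(* the upper bound comes from the lower bound for the inverse exponential *)
have h5 : expR x * (1 - x) <= 1 by rewrite -[leRHS]h3 ler_wpM2l // ltW.
have x2 := sqr_ge0 x; rewrite ler_norml; apply/andP; split.
  apply: (@le_trans _ _ 0); first by rewrite oppr_le0 mulr_ge0.
  lra.
rewrite -subr_le0; have x1 : 0 < 1 - x by lra.
rewrite -(pmulr_lle0 _ x1).
have -> : (expR x - 1 - x - 2 * x ^+ 2) * (1 - x)
          = (expR x * (1 - x) - 1) - x ^+ 2 * (1 - 2 * x) by ring.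
by rewrite subr_le0 (@le_trans _ _ 0) ?subr_le0 // mulr_ge0 //; lra.
Qed.

End RealBounds.

(** * The complex exponential *)

Section ComplexExponential.
Variable R : realType.
Local Notation C := R[i].
Implicit Types (z w : C).

Lemma cexpD z w : cexp (z + w) = cexp z * cexp w.
Proof.
case: z => x y; case: w => x' y'; apply/eqP; rewrite eq_complex /=.
rewrite expRD cosD sinD; apply/andP; split; apply/eqP; ring.
Qed.

Lemma cexp0 : cexp (0 : C) = 1.
Proof. by rewrite /cexp /= expR0 cos0 sin0 mulr1 mulr0. Qed.

Lemma cexp_neq0 z : cexp z != 0.
Proof.
apply/eqP => z0; have := cexpD z (- z).
by rewrite subrr cexp0 z0 mul0r => /eqP; rewrite oner_eq0.
Qed.

Lemma cexpN z : cexp (- z) = (cexp z)^-1.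
Proof.
apply: (mulfI (cexp_neq0 z)); rewrite -cexpD subrr cexp0 mulfV //.
exact: cexp_neq0.
Qed.

Lemma cexpMz z (n : int) : cexp (n%:~R * z) = cexp z ^ n.
Proof.
have nat_case (m : nat) : cexp (m%:R * z) = cexp z ^+ m.
  elim: m => [|m IHm]; first by rewrite mul0r cexp0.
  by rewrite exprS -IHm -cexpD -natr1 mulrDl mul1r addrC.
case: n => m; first exact: nat_case.
by rewrite NegzE mulrNz mulNr cexpN nat_case.
Qed.

Lemma abs_cexpB1Bid_le z : `|z| <= 2^-1 -> `|cexp z - 1 - z| <= 4 * `|z| ^+ 2.
Proof.
move=> z12; rewrite -add_Re2_Im2.
have half : (2^-1 : C) = (2^-1 : R)%:C%C by rewrite fmorphV rmorph_nat.
have rx : `|complex.Re z| <= 2^-1.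
  by rewrite -lecR -half; apply: le_trans z12; apply: normc_ge_Re.
have ry : `|complex.Im z| <= 2^-1.
  by rewrite -lecR -half; apply: le_trans z12; apply: normc_ge_Im.
case: z z12 rx ry => x y _ /= rx ry.
have ce := abs_expRB1Bid_le rx.
have cc := abs_cosB1_le y.
have cs : `|sin y - y| <= y ^+ 2.
  by apply: abs_sinBid_le; apply: (le_trans ry); lra.
have s1 := abs_sin_le y.
set v := _ - _; have vE : v = Complex (expR x * cos y - 1 - x) (expR x * sin y - y).
  by rewrite /v; apply/eqP; rewrite eq_complex /=; apply/andP; split; apply/eqP; ring.
rewrite {v}vE; apply: (le_trans (normc_le_ReIm _)) => /=.
have -> : (4 : C) = (4 : R)%:C%C by rewrite rmorph_nat.
rewrite -rmorphM /= lecR.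
have a1 : `|expR x * cos y - 1 - x| <= 2 * x ^+ 2 + 2 * y ^+ 2.
  have -> : expR x * cos y - 1 - x = (expR x - 1 - x) * cos y + (1 + x) * (cos y - 1).
    ring.
  apply: (le_trans (ler_normD _ _)); rewrite !normrM; apply: lerD.
    rewrite -[leRHS]mulr1; apply: ler_pM => //.
    by rewrite ler_norml cos_geN1 cos_le1.
  apply: ler_pM => //; apply: (le_trans (ler_normD _ _)).
  by rewrite normr1; lra.
have a2 : `|expR x * sin y - y| <= 2 * x ^+ 2 + 2 * y ^+ 2.
  have -> : expR x * sin y - y = (expR x - 1 - x) * sin y + x * sin y + (sin y - y).
    ring.
  apply: (le_trans (ler_normD _ _)).
  have b1 : `|(expR x - 1 - x) * sin y| <= x ^+ 2 * 2 * `|y|.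
    by rewrite normrM (mulrC (x ^+ 2)); apply: ler_pM.
  have b2 : `|x * sin y| <= `|x| * `|y| by rewrite normrM; apply: ler_pM.
  have b3 := ler_normD ((expR x - 1 - x) * sin y) (x * sin y).
  have xx : x ^+ 2 = `|x| ^+ 2 by rewrite real_normK ?num_real.
  have yy : y ^+ 2 = `|y| ^+ 2 by rewrite real_normK ?num_real.
  rewrite xx yy in b1 cs *; have x0 := normr_ge0 x; have y0 := normr_ge0 y.
  have xy : 0 <= `|x| ^+ 2 * (1 - 2 * `|y|) by rewrite mulr_ge0 ?sqr_ge0 //; lra.
  have := sqr_ge0 (`|x| - `|y|); nra.
lra.
Qed.

End ComplexExponential.

(** * The q-Pochhammer symbol and its logarithmic derivative *)

Section QPochhammer.
Variables (R : realType) (a : R[i]).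
Hypothesis a_lt1 : `|a| < 1.
Local Notation C := R[i].
Implicit Types (z : C) (u : C -> C).

Let decay z : geometric_decay (fun i => z * a ^+ i).
Proof. exact/geometric_decayZ/geometric_decay_expr. Qed.

(** The Lambert series of the q-Pochhammer symbol: it is minus the derivative
    of the logarithm of [qpoch z a] with respect to [ln z]. *)
Definition lambert z : C :=
  lim ((\sum_(0 <= i < n) z * a ^+ i / (1 - z * a ^+ i)) @[n --> \oo]).

Lemma cvg_qpoch z :
  \prod_(0 <= i < n) (1 - z * a ^+ i) @[n --> \oo] --> qpoch z a.
Proof. exact/geometric_decay_cvg_prod/decay. Qed.

Lemma cvg_lambert z :
  \sum_(0 <= i < n) z * a ^+ i / (1 - z * a ^+ i) @[n --> \oo] --> lambert z.
Proof. exact/geometric_decay_cvg_series/geometric_decay_quot/decay. Qed.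

Lemma qpoch_shift z : qpoch z a = (1 - z) * qpoch (z * a) a.
Proof.
apply: (cvg_lim (@norm_hausdorff _ C)); rewrite -(cvg_shiftS _ (nbhs _)).
refine (eq_near_cvg (cvgM (cvg_cst (1 - z)) (@cvg_qpoch (z * a))) erefl _).
near=> n; rewrite /= big_nat_recl // expr0 mulr1; congr (_ * _).
by apply: eq_bigr => i _; rewrite exprS mulrA.
Unshelve. all: by end_near. Qed.

Lemma lambert_shift z : lambert z = z / (1 - z) + lambert (z * a).
Proof.
apply: (cvg_lim (@norm_hausdorff _ C)); rewrite -(cvg_shiftS _ (nbhs _)).
refine (eq_near_cvg (cvgD (cvg_cst (z / (1 - z))) (@cvg_lambert (z * a))) erefl _).
near=> n; rewrite /= big_nat_recl // expr0 mulr1; congr (_ + _).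
by apply: eq_bigr => i _; rewrite exprS mulrA.
Unshelve. all: by end_near. Qed.

Lemma qpoch_neq0P z : qpoch z a != 0 <-> forall i, 1 - z * a ^+ i != 0.
Proof.
split=> [z0 i|]; last exact/geometric_decay_prod_neq0/decay.
apply: contra z0 => /eqP zi; apply/eqP.
apply: (cvg_lim (@norm_hausdorff _ C)); apply: cvg_near_cst.
exists i.+1 => // n /= ni.
by rewrite big_mkord (bigD1 (Ordinal ni)) //= zi mul0r.
Qed.

(** Dividing each factor of [qpoch z a] by the same factor at [z0] gives
    [1 - w * c i] with [w = (z - z0) / z0] and [c] the terms of the Lambert
    series at [z0]. The uniform expansion of such products survives the limit. *)
Lemma qpoch_expansion z0 : z0 != 0 -> qpoch z0 a != 0 -> exists M : C,
  \forall z \near z0,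
    `|qpoch z a / qpoch z0 a - 1 - (- (lambert z0 / z0)) * (z - z0)|
    <= M * `|z - z0| ^+ 2.
Proof.
move=> z00 q0; have z0i := (qpoch_neq0P z0).1 q0.
pose c i := z0 * a ^+ i / (1 - z0 * a ^+ i).
have [s0 cs0] := geometric_decay_sum_le (geometric_decay_quot (decay z0)).
have [s s_gt0 cs] : exists2 s : C, 0 < s & forall n, \sum_(0 <= i < n) `|c i| <= s.
  exists (`|s0|%:C%C + 1).
    by rewrite ltr_wpDl // -(rmorph0 (real_complex R)) lecR.
  move=> n; apply: (le_trans (cs0 n)); rewrite -[leLHS]addr0 lerD //.
  by rewrite lecR ler_norm.
exists (2 * (s / `|z0|) ^+ 2).
have e0 : 0 < `|z0| / (2 * s) by rewrite divr_gt0 ?normr_gt0 ?mulr_gt0.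
(* on this disc [|w| * s <= 1/2], as the expansion of the products requires *)
have : \forall z \near z0, `|z0 - z| < `|z0| / (2 * s).
  have /cvgrPdist_lt : z @[z --> z0] --> z0 by apply: cvg_id.
  exact.
apply: filterS => z; rewrite distrC => zz0.
set w := (z - z0) / z0.
have wE : z - z0 = w * z0 by rewrite /w divfK.
have w_small : `|w| * s <= 2^-1.
  move: zz0; rewrite wE normrM mulrC ltr_pM2l ?normr_gt0 // => h.
  by rewrite -ler_pdivlMr // -invfM ltW.
have -> : 2 * (s / `|z0|) ^+ 2 * `|z - z0| ^+ 2 = 2 * (`|w| * s) ^+ 2.
  have n0 : `|z0| != 0 by rewrite normr_eq0.
  by rewrite wE normrM; move: `|z0| n0 `|w| => y y0 v; field.
have h : \prod_(0 <= i < n) (1 - w * c i) - 1 + \sum_(0 <= i < n) w * c i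
         @[n --> \oo] --> qpoch z a / qpoch z0 a - 1 - (- (lambert z0 / z0)) * (z - z0).
  have l1 : qpoch z a * (qpoch z0 a)^-1 - 1 + w * lambert z0 =
    qpoch z a / qpoch z0 a - 1 - (- (lambert z0 / z0)) * (z - z0).
    by rewrite wE; field; rewrite z00 q0.
  rewrite -l1; apply: cvgD; last first.
    under eq_fun do rewrite -mulr_sumr.
    by apply: cvgM; [exact: cvg_cst | exact: cvg_lambert].
  apply: cvgD; last exact: cvg_cst.
  have prodE n : \prod_(0 <= i < n) (1 - w * c i) =
    \prod_(0 <= i < n) (1 - z * a ^+ i) * (\prod_(0 <= i < n) (1 - z0 * a ^+ i))^-1.
    rewrite -prodf_div; apply: eq_bigr => i _.
    by rewrite /c /w; field; rewrite z00 z0i.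
  under eq_fun do rewrite prodE.
  by apply: cvgM; [exact: cvg_qpoch | apply: cvgV => //; exact: cvg_qpoch].
apply: (cvg_norm_le _ h); near=> n.
have ws : \sum_(0 <= i < n) `|w * c i| <= `|w| * s.
  under eq_bigr do rewrite normrM.
  by rewrite -mulr_sumr ler_wpM2l.
have [|_ h2] := @prod1B_expansion _ (fun i => w * c i) n.
  exact: le_trans w_small.
apply: (le_trans h2); rewrite ler_wpM2l // lerXn2r // nnegrE.
  by apply: sumr_ge0.
by rewrite mulr_ge0 // ltW.
Unshelve. all: by end_near. Qed.

Lemma log_derivative_qpoch u nu : log_derivative u nu ->
  qpoch (u 0) a != 0 ->
  log_derivative (fun b => qpoch (u b) a) (- (nu * lambert (u 0))).
Proof.
move=> unu q0; have [u0 _] := unu.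
have [M HM] := qpoch_expansion u0 q0.
have := log_derivative_comp (phi := fun z => qpoch z a) (u := u)
  q0 HM (log_derivative_difference unu).
by congr log_derivative; field.
Qed.

End QPochhammer.

(** * Theta functions *)

Section ThetaFunction.
Variables (R : realType) (a : R[i]).
Hypotheses (a_lt1 : `|a| < 1) (a_neq0 : a != 0).
Local Notation C := R[i].
Implicit Types (z : C) (u : C -> C).

Lemma qpoch_base_neq0 : qpoch a a != 0.
Proof.
apply/(qpoch_neq0P a_lt1) => i; rewrite -exprS subr_eq0 eq_sym.
apply/eqP => /(congr1 Num.norm); rewrite normrX normr1 => /eqP.
by rewrite lt_eqF // exprn_ilt1.
Qed.

(** Passing from [z] to [a z] drops the factor [1 - z] from one product and
    adds the factor [1 - 1/z] to the other. *)
Lemma Theta_shift z : z != 0 -> Theta a (z * a) = - z^-1 * Theta a z.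
Proof.
move=> z0; rewrite /Theta invfM mulrCA mulfV // mulr1.
rewrite (qpoch_shift a_lt1 z) (qpoch_shift a_lt1 z^-1) (mulrC z^-1 a).
by field.
Qed.

Lemma Theta_neq0P z : z != 0 ->
  (Theta a z != 0 <-> forall m : int, 1 - z * a ^ m != 0).
Proof.
move=> z0; rewrite /Theta !mulf_eq0 !negb_or.
have negE n : 1 - a * z^-1 * a ^+ n = - (a ^+ n.+1 / z) * (1 - z * a ^ (Negz n)).
  have -> : a ^ (Negz n) = (a ^+ n.+1)^-1 by [].
  have an : a ^+ n != 0 by rewrite expf_neq0.
  by rewrite exprS; move: (a ^+ n) an => y y0; field; rewrite z0 y0 a_neq0.
have neg0 n : - (a ^+ n.+1 / z) != 0.
  by rewrite oppr_eq0 mulf_neq0 ?invr_neq0 ?expf_neq0.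
split.
- move=> /andP[/andP[/(qpoch_neq0P a_lt1) h1 /(qpoch_neq0P a_lt1) h2] _].
  case=> n; first exact: h1.
  by have := h2 n; rewrite negE mulf_eq0 negb_or => /andP[].
- move=> h; rewrite qpoch_base_neq0 andbT; apply/andP; split.
    by apply/(qpoch_neq0P a_lt1) => i; apply: (h (Posz i)).
  by apply/(qpoch_neq0P a_lt1) => i; rewrite negE mulf_neq0.
Qed.

(** If [u] has logarithmic derivative [nu], then [a / u] has [- nu]; the two
    Pochhammer factors contribute one Lambert series each. *)
Lemma log_derivative_Theta u nu : log_derivative u nu ->
  Theta a (u 0) != 0 ->
  log_derivative (fun b => Theta a (u b))
                 (nu * (lambert a (a / u 0) - lambert a (u 0))).
Proof.
move=> unu; rewrite /Theta !mulf_eq0 !negb_or => /andP[/andP[q1 q2] q3].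
have -> : nu * (lambert a (a / u 0) - lambert a (u 0)) =
  - (nu * lambert a (u 0)) + - ((0 - nu) * lambert a (a / u 0)) + 0 by ring.
have ainv : log_derivative (fun b => a / u b) (0 - nu).
  by apply: log_derivative_div unu; apply: log_derivative_cst.
have h1 := log_derivative_qpoch a_lt1 unu q1.
have h2 := log_derivative_qpoch a_lt1 ainv q2.
exact: log_derivativeM (log_derivativeM h1 h2) (log_derivative_cst q3).
Qed.

End ThetaFunction.

(** * Elliptic theta ratios *)

Section ThetaRatio.
Variables (R : realType) (a q : R[i]).
Hypotheses (a_lt1 : `|a| < 1) (a_neq0 : a != 0) (q_neq0 : q != 0).
Local Notation C := R[i].
Implicit Types (y : C) (u : C -> C).

(** By [Theta_neq0P], for [y != 0] this says that [Theta a y] does not vanish;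
    unlike the latter it is visibly invariant under shifts by powers of [a]. *)
Definition off_lattice y := forall m : int, 1 - y * a ^ m != 0.

Definition regular y :=
  [/\ y != 0, off_lattice y, off_lattice (y * q ^+ 2) & off_lattice (y * q ^- 2)].

Lemma off_latticeM y (m : int) : off_lattice y -> off_lattice (y * a ^ m).
Proof. by move=> ya n; rewrite -mulrA -expfzDr. Qed.

Lemma regularM y (m : int) : regular y -> regular (y * a ^ m).
Proof.
move=> [y0 ya yqa yqa']; split; first by rewrite mulf_neq0 ?expfz_neq0.
- exact: off_latticeM.
- by rewrite mulrAC; apply: off_latticeM.
- by rewrite mulrAC; apply: off_latticeM.
Qed.

Lemma regular_periodic (F : C -> C) :
  (forall y, regular y -> F (y * a) = F y) ->
  forall y (m : int), regular y -> F (y * a ^ m) = F y.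
Proof.
move=> Fa; have nat_case y (n : nat) : regular y -> F (y * a ^ n) = F y.
  elim: n y => [|n IHn] y yr; first by rewrite expr0z mulr1.
  rewrite exprSz mulrA IHn; first exact: Fa.
  by rewrite -[a]expr1z; apply: regularM.
move=> y [n|n] yr; first exact: nat_case.
have -> : F y = F (y * a ^ Negz n * a ^ n.+1).
  by congr F; rewrite -mulrA -expfzDr // NegzE addNr expr0z mulr1.
by rewrite nat_case //; apply: regularM.
Qed.

(** Each factor of the structure function is a quotient of two values of this
    ratio. The multipliers of the theta functions cancel in it, because
    [(y q^2) (y q^-2) = y^2], so it is an elliptic function: periodic under
    [y -> a y]. *)
Definition theta_ratio y :=
  Theta a (y * q ^+ 2) * Theta a (y * q ^- 2) / Theta a y ^+ 2.

Lemma theta_ratio_neq0 y : regular y -> theta_ratio y != 0.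
Proof.
move=> [y0 ya yqa yqa'].
have th z : z != 0 -> off_lattice z -> Theta a z != 0.
  by move=> z0; apply: (Theta_neq0P a_lt1 a_neq0 z0).2.
have q2 : q ^+ 2 != 0 by rewrite expf_neq0.
apply: mulf_neq0; last by rewrite invr_neq0 // expf_neq0 // th.
by apply: mulf_neq0; apply: th => //; rewrite mulf_neq0 ?invr_neq0.
Qed.

Lemma theta_ratio_shift y : regular y -> theta_ratio (y * a) = theta_ratio y.
Proof.
move=> [y0 ya _ _]; have t0 := (Theta_neq0P a_lt1 a_neq0 y0).2 ya.
have q2 : q ^+ 2 != 0 by rewrite expf_neq0.
rewrite /theta_ratio 2![y * a * _]mulrAC !Theta_shift ?mulf_neq0 ?invr_neq0 //.
by move: (Theta a y) t0 => t t0; field; rewrite t0 q_neq0 y0.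
Qed.

(** Second multiplicative difference of the Lambert series, with step [q^2].
    The functions [G_a] of the theorem are the terms of its expansion. *)
Definition lambert_diff2 y := 2 * lambert a y - lambert a (y * q ^+ 2)
  - lambert a (y * q ^- 2).

Definition lambert_diff2_term y := 2 * y / (1 - y) - y * q ^+ 2 / (1 - y * q ^+ 2)
  - y * q ^- 2 / (1 - y * q ^- 2).

(** The logarithmic derivative of [theta_ratio] with respect to [ln y]. *)
Definition theta_ratio_logder y := lambert_diff2 y - lambert_diff2 (a / y).

Lemma log_derivative_theta_ratio u nu : log_derivative u nu ->
  regular (u 0) ->
  log_derivative (fun b => theta_ratio (u b)) (nu * theta_ratio_logder (u 0)).
Proof.
move=> unu [u0 ua uqa uqa']; have q2 : q ^+ 2 != 0 by rewrite expf_neq0.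
have scale c : c != 0 -> log_derivative (fun b => u b * c) nu.
  by move=> c0; rewrite -[nu]addr0; apply: log_derivativeM unu _; apply: log_derivative_cst.
have T c : c != 0 -> off_lattice (u 0 * c) ->
    log_derivative (fun b => Theta a (u b * c))
      (nu * (lambert a (a / (u 0 * c)) - lambert a (u 0 * c))).
  move=> c0 uc.
  apply: (log_derivative_Theta a_lt1 a_neq0 (scale c c0)).
  by apply: (Theta_neq0P a_lt1 a_neq0 _).2 => //; rewrite mulf_neq0.
have T1 := T _ q2 uqa.
have T2 : log_derivative (fun b => Theta a (u b * q ^- 2))
      (nu * (lambert a (a / (u 0 * q ^- 2)) - lambert a (u 0 * q ^- 2))).
  by apply: T; rewrite ?invr_neq0.
have T3 := log_derivative_Theta a_lt1 a_neq0 unu ((Theta_neq0P a_lt1 a_neq0 u0).2 ua).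
have := log_derivative_div (log_derivativeM T1 T2) (log_derivativeX 2 T3).
congr log_derivative; rewrite /theta_ratio_logder /lambert_diff2.
have -> : a / u 0 * q ^+ 2 = a / (u 0 * q ^- 2) by field; rewrite q_neq0 u0.
have -> : a / u 0 * q ^- 2 = a / (u 0 * q ^+ 2) by field; rewrite q_neq0 u0.
by ring.
Qed.

Lemma lambert_diff2_shift y : lambert_diff2 y = lambert_diff2_term y + lambert_diff2 (y * a).
Proof.
rewrite /lambert_diff2 /lambert_diff2_term 2![y * a * _]mulrAC.
rewrite (lambert_shift a_lt1 y) (lambert_shift a_lt1 (y * q ^+ 2)).
by rewrite (lambert_shift a_lt1 (y * q ^- 2)); ring.
Qed.

Lemma cvg_lambert_diff2 y :
  \sum_(0 <= i < n) lambert_diff2_term (y * a ^+ i) @[n --> \oo] --> lambert_diff2 y.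
Proof.
have sumE n : \sum_(0 <= i < n) lambert_diff2_term (y * a ^+ i) =
    2 * (\sum_(0 <= i < n) y * a ^+ i / (1 - y * a ^+ i))
  - \sum_(0 <= i < n) y * q ^+ 2 * a ^+ i / (1 - y * q ^+ 2 * a ^+ i)
  - \sum_(0 <= i < n) y * q ^- 2 * a ^+ i / (1 - y * q ^- 2 * a ^+ i).
  rewrite mulr_sumr -!sumrB; apply: eq_bigr => i _; rewrite /lambert_diff2_term.
  by rewrite 2![y * a ^+ i * _]mulrAC -(mulrA 2).
under eq_fun do rewrite sumE.
apply: cvgB; last exact: (cvg_lambert a_lt1).
apply: cvgB; last exact: (cvg_lambert a_lt1).
by apply: cvgM; [exact: cvg_cst | exact: (cvg_lambert a_lt1)].
Qed.

(** From [u / (1 - u) + u^-1 / (1 - u^-1) = -1]: the second difference kills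
    the constant. *)
Lemma lambert_diff2_term_inv y : regular y ->
  lambert_diff2_term y + lambert_diff2_term y^-1 = 0.
Proof.
move=> [y0 /(_ 0) y1 /(_ 0) y2 /(_ 0) y3].
rewrite !expr0z !mulr1 in y1 y2 y3.
have q2 : q ^+ 2 != 0 by rewrite expf_neq0.
have inv_pair (z : C) : z != 0 -> 1 - z != 0 -> z / (1 - z) + z^-1 / (1 - z^-1) = -1.
  move=> z0 z1; have z1' : z - 1 != 0 by rewrite -opprB oppr_eq0.
  by field; rewrite z0 z1 z1'.
have e1 := inv_pair _ y0 y1.
have e2 : y * q ^+ 2 / (1 - y * q ^+ 2) + y^-1 * q ^- 2 / (1 - y^-1 * q ^- 2) = -1.
  by rewrite -invfM; apply: inv_pair; rewrite ?mulf_neq0.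
have e3 : y * q ^- 2 / (1 - y * q ^- 2) + y^-1 * q ^+ 2 / (1 - y^-1 * q ^+ 2) = -1.
  by rewrite -[q ^+ 2]invrK -invfM invrK; apply: inv_pair; rewrite ?mulf_neq0 ?invr_neq0.
have -> : 0 = 2 * (-1) - (-1) - (-1) :> C by ring.
by rewrite -{1}e1 -{1}e2 -e3 /lambert_diff2_term; ring.
Qed.

(** The shift moves one term from the first series to the second; by
    antisymmetry the two contributions cancel. *)
Lemma theta_ratio_logder_shift y : regular y ->
  theta_ratio_logder (y * a) = theta_ratio_logder y.
Proof.
move=> yr; have [y0 _ _ _] := yr.
have ainv : a / (y * a) = y^-1 by rewrite invfM mulrCA mulfV // mulr1.
have s1 := lambert_diff2_shift y; have s2 := lambert_diff2_shift y^-1.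
have s3 := lambert_diff2_term_inv yr.
rewrite /theta_ratio_logder ainv s1 s2 (mulrC a).
have -> : lambert_diff2_term y^-1 = - lambert_diff2_term y.
  by apply/eqP; rewrite -addr_eq0 addrC s3.
by ring.
Qed.

(** The series at [a / y] is the series at [1 / y] without its first term. By
    antisymmetry that missing term can be shared evenly between the two
    series, which is the origin of the terms [- G_0 / 2] in the theorem. *)
Lemma theta_ratio_logderE y : regular y ->
  theta_ratio_logder y = (lambert_diff2 y - 2^-1 * lambert_diff2_term y)
    - (lambert_diff2 y^-1 - 2^-1 * lambert_diff2_term y^-1).
Proof.
move=> yr; have s2 := lambert_diff2_shift y^-1; have s3 := lambert_diff2_term_inv yr.
rewrite /theta_ratio_logder s2 (mulrC a).
have -> : lambert_diff2_term y^-1 = - lambert_diff2_term y.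
  by apply/eqP; rewrite -addr_eq0 addrC s3.
by field.
Qed.

End ThetaRatio.

(** * The structure function near beta = 0 *)

Section StructureFunction.
Variables (R : realType) (N : nat) (M h : int) (lnq : R[i]).
Hypotheses (N_gt0 : (0 < N)%N) (q_lt1 : `|cexp lnq| < 1).
Local Notation C := R[i].
Local Notation q := (cexp lnq).
Local Notation a := (cexp lnq ^+ (2 * N)).
Local Notation p := (pbeta N h lnq).
Local Notation nu := (N%:R * h%:~R * lnq : C).
Implicit Types (x : C) (k : nat).

Let q_neq0 : q != 0. Proof. exact: cexp_neq0. Qed.
Let a_neq0 : a != 0. Proof. by rewrite expf_neq0. Qed.
Let a_lt1 : `|a| < 1.
Proof. by rewrite normrX exprn_ilt1 // muln_eq0 -lt0n. Qed.

Lemma pbeta0 : p 0 = q ^ (N%:Z * h).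
Proof.
by rewrite /pbeta subr0 divr1 -cexpMz intrM.
Qed.

Lemma pbeta0X k : p 0 ^+ k = q ^ (N%:Z * (h * k%:Z)).
Proof. by rewrite pbeta0 exprnP exprz_exp -mulrA. Qed.

Lemma pbeta0_sqrX k : p 0 ^+ k = p 0 ^- k * a ^ (h * k%:Z).
Proof.
rewrite pbeta0X exprnP exprz_exp invr_expz -expfzDr //; congr (q ^ _).
by rewrite PoszM; ring.
Qed.

(** At [beta = 0] the square of [p] is [a ^ h], so the arguments [y p^k] and
    [y p^-k] differ by an integral power of the period [a]. Both the
    triviality of the structure function at [beta = 0] and the symmetry of its
    derivative rest on this. *)
Lemma pbeta0_shift (y : C) k :
  y * p 0 ^+ k = y * p 0 ^- k * a ^ (h * k%:Z).
Proof. by rewrite {1}pbeta0_sqrX mulrA. Qed.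

(** The exponent [nu / (1 - beta)] has derivative [nu] at 0. *)
Lemma log_derivative_pbeta : log_derivative p nu.
Proof.
have quot : difference_quotient_cvg (fun b : C => nu / (1 - b)) nu.
  have id0 : b @[b --> (0 : C)^'] --> (0 : C) by apply: nbhs_dnbhs.
  have lim1 : 1 - b @[b --> (0 : C)^'] --> (1 - 0 : C).
    by apply: cvgD; [exact: cvg_cst | apply: cvgN].
  have b1 : (1 - 0 : C) != 0 by rewrite subr0 oner_neq0.
  refine (eq_near_cvg (cvgM (cvg_cst nu) (cvgV b1 lim1)) _ _).
    by rewrite subr0 invr1 mulr1.
  near=> b => /=.
  have b0 : b != 0 by near: b; apply: nbhs_dnbhs_neq.
  have bn1 : 1 - b != 0 by near: b; exact: (cvgr_neq0 _ lim1).
  by rewrite subr0 divr1; field; rewrite bn1 b0.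
rewrite -[X in log_derivative _ X]mul1r.
apply: (log_derivative_comp (phi := cexp (R := R)) (M := 4) _ _ quot).
  exact: cexp_neq0.
set z0 := _ / _.
have : \forall z \near z0, `|z0 - z| < 2^-1.
  have /cvgrPdist_lt : z @[z --> z0] --> z0 by apply: cvg_id.
  by apply; rewrite invr_gt0.
apply: filterS => z /ltW; rewrite distrC mul1r.
rewrite -cexpN -cexpD; exact: abs_cexpB1Bid_le.
Unshelve. all: by end_near. Qed.

Lemma Yden_neq0 (P x : C) k : Yden N P q x k != 0 ->
  [/\ Theta a (x ^+ 2 * P ^+ k) != 0, Theta a (x ^+ 2 * q ^+ 2 * P ^- k) != 0
    & Theta a (x ^+ 2 * q ^- 2 * P ^- k) != 0].
Proof.
rewrite /Yden mulf_eq0 negb_or => /andP[]; rewrite mulf_eq0 negb_or.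
move=> /andP[t1 t2] t3; split => //.
by apply: contra t1 => /eqP ->; rewrite expr0n.
Qed.

(** The denominator of the structure function mixes [p^k] and [p^-k]; at
    [beta = 0] the two are equivalent modulo periods, so its three theta
    functions control all the arguments that occur. *)
Lemma Yregular_pbeta0 x k : x != 0 -> Yregular N (p 0) q M x ->
  (1 <= k <= Klen N M)%N -> regular a q (x ^+ 2 * p 0 ^- k).
Proof.
move=> x0 yr /yr; have p0 : p 0 ^+ k != 0 by rewrite expf_neq0 ?cexp_neq0.
have y0 : x ^+ 2 != 0 by rewrite expf_neq0.
have q2 : q ^+ 2 != 0 by rewrite expf_neq0.
have th (z : C) : z != 0 -> Theta a z != 0 -> off_lattice a z.
  by move=> z0; apply: (Theta_neq0P a_lt1 a_neq0 z0).1.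
move=> /Yden_neq0[t1 t2 t3].
split; first by rewrite mulf_neq0 ?invr_neq0.
- move: (th _ (mulf_neq0 y0 p0) t1) => /(off_latticeM a_neq0 (- (h * k%:Z))).
  by rewrite pbeta0_shift -(mulrA (_ / _)) -expfzDr // subrr expr0z mulr1.
- by rewrite mulrAC; apply: th => //; rewrite !mulf_neq0 ?invr_neq0.
- by rewrite mulrAC; apply: th => //; rewrite !mulf_neq0 ?invr_neq0.
Qed.

Lemma Yfun_theta_ratio (P x : C) : Yfun N P q M x =
  \prod_(1 <= k < (Klen N M).+1)
    (theta_ratio a q (x ^+ 2 * P ^+ k) / theta_ratio a q (x ^+ 2 * P ^- k)).
Proof.
apply: eq_bigr => k _; rewrite /Ynum /Yden /theta_ratio.
rewrite [x ^+ 2 * P ^+ k * q ^+ 2]mulrAC [x ^+ 2 * P ^+ k * q ^- 2]mulrAC.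
rewrite [x ^+ 2 * P ^- k * q ^+ 2]mulrAC [x ^+ 2 * P ^- k * q ^- 2]mulrAC.
have frac (A B D E F G : C) : (B * D * E) / (A * F * G) = (D * E / A) / (F * G / B).
  by rewrite !invfM !invrK; ring.
exact: frac.
Qed.

Lemma Yfun_pbeta0 x : x != 0 -> Yregular N (p 0) q M x ->
  Yfun N (p 0) q M x = 1.
Proof.
move=> x0 yr; rewrite Yfun_theta_ratio big_nat; apply: big1 => k.
rewrite ltnS => k1; have kr := Yregular_pbeta0 x0 yr k1.
rewrite pbeta0_shift.
rewrite (regular_periodic (q := q) a_neq0 (F := theta_ratio a q)) //.
  by rewrite mulfV // theta_ratio_neq0.
by move=> y; apply: theta_ratio_shift.
Qed.

Lemma log_derivative_pbetaZ (c : C) k : c != 0 ->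
  log_derivative (fun b => c * p b ^+ k) (k%:R * nu) /\
  log_derivative (fun b => c * p b ^- k) (- (k%:R * nu)).
Proof.
move=> c0; have pk := log_derivativeX k log_derivative_pbeta.
split; rewrite -[X in log_derivative _ X]add0r.
- exact: log_derivativeM (log_derivative_cst c0) pk.
- exact: log_derivativeM (log_derivative_cst c0) (log_derivativeV pk).
Qed.

(** The numerator of the [k]-th factor contributes [k nu] and its denominator
    [- k nu] times a logarithmic derivative of [theta_ratio]; the two values
    agree by periodicity, hence the factor 2. *)
Lemma log_derivative_Yfun x : x != 0 -> Yregular N (p 0) q M x ->
  log_derivative (fun b => Yfun N (p b) q M x)
    (\sum_(1 <= k < (Klen N M).+1)
       2 * k%:R * nu * theta_ratio_logder a q (x ^+ 2 * p 0 ^+ k)).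
Proof.
move=> x0 yr.
under eq_fun do rewrite Yfun_theta_ratio.
apply: log_derivative_prod => k; rewrite mem_index_iota ltnS => k1.
have kr := Yregular_pbeta0 x0 yr k1.
have kr' : regular a q (x ^+ 2 * p 0 ^+ k).
  by rewrite pbeta0_shift; apply: regularM.
have [h1 h2] := log_derivative_pbetaZ k (expf_neq0 2 x0).
have h3 := log_derivative_theta_ratio a_lt1 a_neq0 q_neq0 h1 kr'.
have h4 := log_derivative_theta_ratio a_lt1 a_neq0 q_neq0 h2 kr.
have Dk : theta_ratio_logder a q (x ^+ 2 * p 0 ^- k) = theta_ratio_logder a q (x ^+ 2 * p 0 ^+ k).
  rewrite pbeta0_shift.
  rewrite (regular_periodic (q := q) a_neq0 (F := theta_ratio_logder a q)) // => y.
  exact: theta_ratio_logder_shift.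
have := log_derivative_div h3 h4; rewrite Dk.
by congr log_derivative; ring.
Qed.

(** The product of the finitely many denominators has a logarithmic derivative
    at 0, so it stays nonzero near 0, and with it every denominator. *)
Lemma near_Yregular x : x != 0 -> Yregular N (p 0) q M x ->
  \forall b \near (0 : C)^', Yregular N (p b) q M x.
Proof.
move=> x0 yr.
have y0 : x ^+ 2 != 0 by rewrite expf_neq0.
have q2 : q ^+ 2 != 0 by rewrite expf_neq0.
have q2' : q ^- 2 != 0 by rewrite invr_neq0.
have /choice[l Hl] : forall k, exists l : C, (1 <= k <= Klen N M)%N ->
    log_derivative (fun b => Yden N (p b) q x k) l.
  move=> k.
  case: (boolP (1 <= k <= Klen N M)%N) => k1; last by exists 0.
  have [t1 t2 t3] := Yden_neq0 (yr k k1).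
  have [h1 _] := log_derivative_pbetaZ k y0.
  have [_ h2] := log_derivative_pbetaZ k (mulf_neq0 y0 q2).
  have [_ h3] := log_derivative_pbetaZ k (mulf_neq0 y0 q2').
  have T1 := log_derivative_Theta a_lt1 a_neq0 h1 t1.
  have T2 := log_derivative_Theta a_lt1 a_neq0 h2 t2.
  have T3 := log_derivative_Theta a_lt1 a_neq0 h3 t3.
  have T := log_derivativeM (log_derivativeM (log_derivativeX 2 T1) T2) T3.
  by eexists => _; exact: T.
have Hprod := @log_derivative_prod _ _ (index_iota 1 (Klen N M).+1)
  (fun k b => Yden N (p b) q x k) l.
have /Hprod/log_derivative_neq0 : forall k, k \in index_iota 1 (Klen N M).+1 ->
    log_derivative (fun b => Yden N (p b) q x k) (l k).
  by move=> k; rewrite mem_index_iota ltnS; exact: Hl.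
apply: filterS => b; rewrite prodf_seq_neq0 => /allP Yb k k1.
by apply: (Yb k); rewrite mem_index_iota ltnS.
Qed.

End StructureFunction.

(** * Arithmetic of the number of factors *)

Section ParitySums.
Implicit Types (n : int) (N K : nat) (M : int).

Lemma int_parity n : exists j : int, n = 2 * j + (odd `|n|)%:Z.
Proof. by exists (n %/ 2)%Z; lia. Qed.

Lemma EhalfE n : Ehalf n = (n %/ 2)%Z.
Proof.
apply: floor_def; rewrite ler_pdivlMr // ltr_pdivrMr //.
by rewrite -[2 : rat]/(2%:~R) -!intrM ler_int ltr_int; lia.
Qed.

(** The two cases in the definition of the number [K] of factors are exchanged
    by the reflection [m -> - m - 1], under which [m (m + 1)] and the
    coefficients of the theorem are invariant. This is why one formula serves
    both signs of [M]. *)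
Lemma Klen_cases N M : (0 < N)%N -> M != 0 ->
  N%:Z * M = Klen N M \/ N%:Z * M = - (Klen N M)%:Z - 1.
Proof.
move=> N0 M0; rewrite /Klen; case: ifP => M_gt0.
  by left; rewrite PoszM gtz0_abs.
right; have : (0 < N * `|M|)%N by rewrite muln_gt0 N0 absz_gt0.
have -> : M = - (`|M|%N : int) by lia.
by rewrite abszN absz_nat mulrN -PoszM; lia.
Qed.

Lemma Klen_gt0 N M : (2 <= N)%N -> M != 0 -> (0 < Klen N M)%N.
Proof.
rewrite -absz_gt0 /Klen => N2 M0; have := leq_mul N2 M0.
by case: ifP => _; lia.
Qed.

Lemma Ehalf_mul_succ N M : (0 < N)%N -> M != 0 ->
  Ehalf (N%:Z * M) * (Ehalf (N%:Z * M) + 1) = ((Klen N M)./2 * (Klen N M)./2.+1)%N.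
Proof.
move=> N0 M0; rewrite EhalfE PoszM -natz -natr1 natz.
have [->|->] := Klen_cases N0 M0; move: (Klen N M) => K.
- have -> : (K%:Z %/ 2)%Z = K./2 by lia.
  by ring.
- have -> : ((- K%:Z - 1) %/ 2)%Z = - (K./2)%:Z - 1 by lia.
  by ring.
Qed.

Lemma Ehalf_succ_sqr N M : (0 < N)%N -> M != 0 ->
  Ehalf (N%:Z * M + 1) ^+ 2 = (uphalf (Klen N M) * uphalf (Klen N M))%N.
Proof.
move=> N0 M0; rewrite EhalfE PoszM.
have [->|->] := Klen_cases N0 M0; move: (Klen N M) => K.
- have -> : ((K%:Z + 1) %/ 2)%Z = uphalf K by lia.
  by ring.
- have -> : ((- K%:Z - 1 + 1) %/ 2)%Z = - (uphalf K)%:Z by lia.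
  by ring.
Qed.

Lemma sum_2id K : (\sum_(1 <= k < K.+1) 2 * k = K * K.+1)%N.
Proof.
elim: K => [|K IHK]; first by rewrite big_geq.
by rewrite big_nat_recr // IHK /=; lia.
Qed.

Lemma sum_even_odd K :
  (\sum_(1 <= k < K.+1) ~~ odd k * k = K./2 * K./2.+1)%N /\
  (\sum_(1 <= k < K.+1) odd k * k = uphalf K * uphalf K)%N.
Proof.
elim: K => [|K [IH1 IH2]]; first by rewrite !big_geq.
split; rewrite big_nat_recr //=; rewrite ?IH1 ?IH2 uphalf_half.
  by have := odd_double_half K; case: (odd K) => /=; nia.
by have := odd_double_half K; case: (odd K) => /=; nia.
Qed.

End ParitySums.

(** * The coefficient of the Poisson bracket *)

Section PoissonCoefficient.
Variables (R : realType) (N : nat) (M h : int) (lnq : R[i]).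
Hypotheses (N_gt0 : (0 < N)%N) (M_neq0 : M != 0) (q_lt1 : `|cexp lnq| < 1).
Local Notation C := R[i].
Local Notation q := (cexp lnq).
Local Notation a := (cexp lnq ^+ (2 * N)).
Local Notation p := (pbeta N h lnq).
Local Notation nu := (N%:R * h%:~R * lnq : C).
Local Notation K := (Klen N M).
Implicit Types (x y : C) (k : nat).

Let q_neq0 : q != 0. Proof. exact: cexp_neq0. Qed.
Let a_neq0 : a != 0. Proof. by rewrite expf_neq0. Qed.
Let a_lt1 : `|a| < 1.
Proof. by rewrite normrX exprn_ilt1 // muln_eq0 -lt0n. Qed.

Lemma GfunE (n : int) x : Gfun q n x = lambert_diff2_term q (x ^+ 2 * q ^ n).
Proof.
rewrite /Gfun /lambert_diff2_term (expfzDr n 2) // (expfzDr n (- 2)) //.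
by rewrite !mulrA.
Qed.

Lemma cvg_sum_Gfun x (r : nat) :
  \sum_(0 <= l < n) Gfun q (2 * N * l + r)%N x @[n --> \oo] -->
  lambert_diff2 a q (x ^+ 2 * q ^+ r).
Proof.
under eq_fun => n.
  under eq_bigr => l _.
    rewrite GfunE -exprnP addnC exprD exprM mulrA.
    over.
  over.
exact: cvg_lambert_diff2.
Qed.

Lemma feven_bracketE x : feven_bracket N q x =
  lambert_diff2 a q (x ^+ 2) - 2^-1 * lambert_diff2_term q (x ^+ 2).
Proof.
rewrite /feven_bracket GfunE expr0z mulr1; congr (_ - _).
apply: (cvg_lim (@norm_hausdorff _ C)).
have := @cvg_sum_Gfun x 0; rewrite expr0 mulr1.
by under eq_fun do under eq_bigr do rewrite addn0.
Qed.

Lemma fodd_bracketE x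
  (e0 := (Ehalf (N%:Z * M) * (Ehalf (N%:Z * M) + 1))%:~R : C)
  (e1 := (Ehalf (N%:Z * M + 1) ^+ 2)%:~R : C) :
  fodd_bracket N q M x =
  e0 * (lambert_diff2 a q (x ^+ 2) - 2^-1 * lambert_diff2_term q (x ^+ 2))
  + e1 * lambert_diff2 a q (x ^+ 2 * q ^+ N).
Proof.
rewrite /fodd_bracket GfunE expr0z mulr1 -/e0 -/e1.
have -> : lim ((\sum_(0 <= l < n) (e0 * Gfun q (2 * N * l)%N x
    + e1 * Gfun q (2 * N * l + N)%N x)) @[n --> \oo]) =
    e0 * lambert_diff2 a q (x ^+ 2) + e1 * lambert_diff2 a q (x ^+ 2 * q ^+ N).
  apply: (cvg_lim (@norm_hausdorff _ C)).
  under eq_fun do rewrite big_split /= -!mulr_sumr.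
  apply: cvgD; apply: cvgM; try exact: cvg_cst; last exact: cvg_sum_Gfun.
  have := @cvg_sum_Gfun x 0; rewrite expr0 mulr1.
  by under eq_fun do under eq_bigr do rewrite addn0.
by ring.
Qed.

(** Modulo the period [a = q^(2 N)], the power [p^k = q^(N h k)] only depends
    on the parity of [h k]: this separates the cases [h] even and [h] odd. *)
Lemma pbeta0_parity k : exists j : int,
  p 0 ^+ k = q ^+ (N * odd `|h * k%:Z|) * a ^ j.
Proof.
have [j hk] := int_parity (h * k%:Z); exists j.
rewrite pbeta0X [in LHS]hk exprnP exprnP exprz_exp -expfzDr //.
by congr (q ^ _); rewrite !PoszM; ring.
Qed.

Section AtRegularPoint.
Variable x : C.
Hypotheses (x_neq0 : x != 0) (x_regular : Yregular N (p 0) q M x).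

Lemma regular_parity k : (1 <= k <= K)%N ->
  regular a q (x ^+ 2 * q ^+ (N * odd `|h * k%:Z|)).
Proof.
move=> k1; have [j kj] := pbeta0_parity k.
have := Yregular_pbeta0 N_gt0 q_lt1 x_neq0 x_regular k1.
move=> /(regularM a_neq0 (h * k%:Z)); rewrite -pbeta0_shift // kj mulrA.
move=> /(regularM a_neq0 (- j)).
by rewrite -(mulrA (_ * _)) -expfzDr // subrr expr0z mulr1.
Qed.

Lemma theta_ratio_logder_parity k : (1 <= k <= K)%N ->
  theta_ratio_logder a q (x ^+ 2 * p 0 ^+ k) =
  theta_ratio_logder a q (x ^+ 2 * q ^+ (N * odd `|h * k%:Z|)).
Proof.
move=> k1; have [j ->] := pbeta0_parity k; rewrite mulrA.
rewrite (regular_periodic (q := q) a_neq0 (F := theta_ratio_logder a q)) //.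
  by move=> y; apply: theta_ratio_logder_shift.
exact: regular_parity.
Qed.

Lemma sum_theta_ratio_logder_even : (2 <= N)%N -> ~~ odd `|h| ->
  \sum_(1 <= k < K.+1) 2 * k%:R * nu * theta_ratio_logder a q (x ^+ 2 * p 0 ^+ k) =
  fh N M h lnq x.
Proof.
move=> N2 h_even; have hk k : odd `|h * k%:Z| = false.
  by rewrite abszM oddM (negbTE h_even).
rewrite /fh (negbTE h_even) !feven_bracketE exprVn.
have Kg0 : (0 < K)%N by apply: Klen_gt0.
have yr : regular a q (x ^+ 2).
  by have := @regular_parity 1; rewrite hk muln0 expr0 mulr1; apply.
rewrite -theta_ratio_logderE //.
transitivity (nu * theta_ratio_logder a q (x ^+ 2) * (\sum_(1 <= k < K.+1) 2 * k)%N%:R).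
  rewrite natr_sum mulr_sumr; apply: eq_big_nat => k; rewrite ltnS => k1.
  by rewrite theta_ratio_logder_parity // hk muln0 expr0 mulr1 natrM; ring.
have -> : (\sum_(1 <= k < K.+1) 2 * k)%N%:R = N%:R * M%:~R * (N%:R * M%:~R + 1) :> C.
  rewrite sum_2id natrM -natr1.
  have -> : N%:R * M%:~R = (N%:Z * M)%:~R :> C by rewrite intrM.
  by have [->|->] := Klen_cases N_gt0 M_neq0; rewrite ?rmorphB ?rmorphN /=; ring.
by ring.
Qed.

(** Even [k] contribute the logarithmic derivative at [x^2] and odd [k] the one
    at [x^2 q^N]. In the latter the series at [a / (x^2 q^N) = x^-2 q^N] is
    already the one obtained by inverting [x], so no half term appears. *)
Lemma sum_theta_ratio_logder_odd : odd `|h| ->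
  \sum_(1 <= k < K.+1) 2 * k%:R * nu * theta_ratio_logder a q (x ^+ 2 * p 0 ^+ k) =
  fh N M h lnq x.
Proof.
move=> h_odd; have hk k : odd `|h * k%:Z| = odd k by rewrite abszM oddM h_odd.
rewrite /fh h_odd !fodd_bracketE.
have [E0 E1] := sum_even_odd K.
have -> : Ehalf (N%:Z * M) * (Ehalf (N%:Z * M) + 1) = (K./2 * K./2.+1)%N.
  exact: Ehalf_mul_succ.
have -> : Ehalf (N%:Z * M + 1) ^+ 2 = (uphalf K * uphalf K)%N.
  exact: Ehalf_succ_sqr.
rewrite -E0 -E1; set D := theta_ratio_logder a q.
transitivity (2 * nu * ((\sum_(1 <= k < K.+1) ~~ odd k * k)%N%:R * D (x ^+ 2)
   + (\sum_(1 <= k < K.+1) odd k * k)%N%:R * D (x ^+ 2 * q ^+ N))).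
  rewrite !natr_sum !mulr_suml -big_split mulr_sumr /=.
  apply: eq_big_nat => k; rewrite ltnS => k1.
  rewrite [D (_ * pbeta _ _ _ _ ^+ _)]theta_ratio_logder_parity // hk -/D !natrM.
  by case: (odd k); rewrite ?muln1 ?muln0 ?expr0 ?mulr1 /=; ring.
have D1 : D (x ^+ 2 * q ^+ N) =
    lambert_diff2 a q (x ^+ 2 * q ^+ N) - lambert_diff2 a q ((x ^+ 2)^-1 * q ^+ N).
  congr (_ - lambert_diff2 a q _); rewrite mul2n -addnn exprD.
  have qN : q ^+ N != 0 by rewrite expf_neq0.
  by field; rewrite qN x_neq0.
have D0 : (\sum_(1 <= k < K.+1) ~~ odd k * k)%N%:R * D (x ^+ 2) =
    (\sum_(1 <= k < K.+1) ~~ odd k * k)%N%:R *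
    ((lambert_diff2 a q (x ^+ 2) - 2^-1 * lambert_diff2_term q (x ^+ 2))
    - (lambert_diff2 a q (x ^+ 2)^-1 - 2^-1 * lambert_diff2_term q (x ^+ 2)^-1)) :> C.
  (* for K = 1 nothing is known about the point x ^ 2, but then its
     coefficient is 0 *)
  have [K2|K1] := leqP 2 K.
    congr (_ * _); apply: theta_ratio_logderE => //.
    by have := @regular_parity 2; rewrite hk muln0 expr0 mulr1; apply.
  by rewrite E0; case: K K1 => [|[|]] //= _; rewrite !mul0r.
rewrite D0 D1 -(exprVn x 2) -!pmulrn; move: (\sum_(_ <= k < _) ~~ _ * _)%N => s0.
by move: (\sum_(_ <= k < _) _)%N => s1; ring.
Qed.

End AtRegularPoint.
End PoissonCoefficient.

(** * The Poisson bracket *)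

Theorem theorem7 (R : realType) (V : topologicalLmodType R[i])
    (V_hausdorff : hausdorff_space V)
    (A : algebra_family V) (t : R[i] -> R[i] -> V)
    (N : nat) (M h : int) (lnq : R[i])
    (N_ge2 : (2 <= N)%N) (M_neq0 : M != 0) (h_neq0 : h != 0)
    (q_lt1 : `|cexp lnq| < 1)
    (t_cvg : forall z, z != 0 -> t b z @[b --> (0 : R[i])^'] --> t 0 z)
    (t_exchange : forall z w, z != 0 -> w != 0 ->
       \forall b \near (0 : R[i])^',
         Yregular N (pbeta N h lnq b) (cexp lnq) M (w / z) ->
         exchange_relation A t N M h lnq b z w)
    (z w : R[i]) (z_neq0 : z != 0) (w_neq0 : w != 0)
    (zw_regular : Yregular N (pbeta N h lnq 0) (cexp lnq) M (w / z)) :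
  is_poisson_bracket A t z w
    (fh N M h lnq (w / z) *: fmul A 0 (t 0 z) (t 0 w)).
Proof.
have N_gt0 : (0 < N)%N by apply: ltnW.
have x_neq0 : w / z != 0 by rewrite mulf_neq0 ?invr_neq0.
set x := w / z in x_neq0 zw_regular *.
pose Y b := Yfun N (pbeta N h lnq b) (cexp lnq) M x.
have Y0 : Y 0 = 1 by apply: Yfun_pbeta0.
have YfE : log_derivative Y (fh N M h lnq x).
  have := log_derivative_Yfun N_gt0 q_lt1 x_neq0 zw_regular.
  have [h_odd|h_even] := boolP (odd `|h|).
  - by rewrite sum_theta_ratio_logder_odd.
  - by rewrite sum_theta_ratio_logder_even.
have exchange : \forall b \near (0 : R[i])^', fmul A b (t b z) (t b w) =
    Y b *: fmul A b (t b w) (t b z).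
  have near_reg := near_Yregular N_gt0 q_lt1 x_neq0 zw_regular.
  by apply: filterS2 (t_exchange _ _ z_neq0 w_neq0) near_reg => b; apply.
have b_cvg : b @[b --> (0 : R[i])^'] --> (0 : R[i]) by apply: nbhs_dnbhs.
have mul_cvg u v : u != 0 -> v != 0 ->
    fmul A b (t b u) (t b v) @[b --> (0 : R[i])^'] --> fmul A 0 (t 0 u) (t 0 v).
  move=> u0 v0.
  have bt : (b, t b u, t b v) @[b --> (0 : R[i])^'] --> ((0 : R[i]), t 0 u, t 0 v).
    have bu : (b, t b u) @[b --> (0 : R[i])^'] --> ((0 : R[i]), t 0 u).
      exact (cvg_pair b_cvg (t_cvg _ u0)).
    exact (cvg_pair bu (t_cvg _ v0)).
  have cont := @fmul_continuous0 _ _ A (t 0 u) (t 0 v).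
  exact: (cvg_comp (fun b => (b, t b u, t b v))
    (fun y : R[i] * V * V => fmul A y.1.1 y.1.2 y.2) bt cont).
have scale_cvg (s : R[i] -> R[i]) (f : R[i] -> V) (k : R[i]) (v : V) :
    s b @[b --> (0 : R[i])^'] --> k -> f b @[b --> (0 : R[i])^'] --> v ->
    s b *: f b @[b --> (0 : R[i])^'] --> k *: v.
  move=> sk fv.
  have sf : (s b, f b) @[b --> (0 : R[i])^'] --> (k, v).
    exact (cvg_pair sk fv).
  have cont := @scale_continuous _ V (k, v).
  exact: (cvg_comp (fun b => (s b, f b)) (fun y : R[i] * V => y.1 *: y.2) sf cont).
(* both orders of the product have the same limit because Y 0 = 1 *)
have commute0 : fmul A 0 (t 0 z) (t 0 w) = fmul A 0 (t 0 w) (t 0 z).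
  apply: (cvg_unique V_hausdorff (mul_cvg _ _ z_neq0 w_neq0)).
  have Ymul := scale_cvg _ _ _ _ (log_derivative_continuous YfE)
    (mul_cvg _ _ w_neq0 z_neq0).
  apply: (eq_near_cvg Ymul); first by rewrite Y0 scale1r.
  by apply: filterS exchange => b ->.
have [_ Yquot] := YfE.
have limit := scale_cvg _ _ _ _ Yquot (mul_cvg _ _ w_neq0 z_neq0).
apply: (eq_near_cvg limit); first by rewrite commute0.
apply: filterS exchange => b ->.
by rewrite Y0 !divr1 -scalerA scalerBl scale1r.
Qed.
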